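(* Let $(\rho(t))_{t\ge0}$ be the solution of the stochastic master equation described in the context, $\hat\rho(t)=\mathbb E[\rho(t)]$, $\mathcal H_S$ a subspace of $\mathcal H$ with orthogonal projector $P_S$, $P_R=I-P_S$ and $V(\rho)=\mathrm{tr}(P_R\rho)$. Assume $\mathcal H_S$ is GAS and let $\alpha_0>0$ be such that, for every initial state, $\limsup_{t\to\infty}\frac1t\ln V(\hat\rho(t))\le-\alpha_0$ and $\limsup_{t\to\infty}\frac1t\ln V(\rho(t))\le-\alpha_0$ a.s. (such $\alpha_0$ exists). Then for every initial state and any $\epsilon>0$, $$\|\rho(t)-P_S\rho(t)P_S\|=o\big(e^{-\frac12(\alpha_0-\epsilon)t}\big)\quad\text{as }t\to\infty,\ \text{a.s. and in }L^1\text{-norm}.$$ If moreover condition (SP) holds, namely $P_RC_j^*P_RC_jP_R>0$ (positive definite on $P_R\mathcal H$) for all $j=p+1,\dots,n$, and $\beta_0\ge\alpha_0$ is such that, for every initial state, $\limsup_{t\to\infty}\frac1t\ln V(\rho(t))\le-\beta_0$ a.s. (such $\beta_0$ exists), then for every initial state and any $\epsilon>0$, $$\|\rho(t)-P_S\rho(t)P_S\|=o\big(e^{-\frac12(\beta_0-\epsilon)t}\big)\quad\text{as }t\to\infty,\ \text{a.s.}$$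
   Context: $\mathcal H$ is a finite-dimensional complex Hilbert space, $\mathcal B(\mathcal H)$ the linear operators on it (with any norm $\|\cdot\|$), and $\mathcal S(\mathcal H)=\{\rho\in\mathcal B(\mathcal H):\rho\ge 0,\ \mathrm{tr}\,\rho=1\}$. Fix integers $0\le p\le n$, operators $C_0,\dots,C_n\in\mathcal B(\mathcal H)$ and a self-adjoint $H\in\mathcal B(\mathcal H)$. Set $\mathcal L(\rho)=-i[H,\rho]+\sum_{i=0}^n\big(C_i\rho C_i^*-\tfrac12(C_i^*C_i\rho+\rho C_i^*C_i)\big)$, $\mathcal J_i(\rho)=C_i\rho C_i^*$, $\mathcal G_i(\rho)=C_i\rho+\rho C_i^*-\mathrm{tr}[(C_i+C_i^* )\rho]\rho$. Stochastic master equation: on a filtered probability space $(\Omega,\mathcal F,(\mathcal F_t),\mathbb P)$ satisfying the usual conditions, let $W_0,\dots,W_p$ be independent standard Wiener processes and $N_{p+1},\dots,N_n$ independent Poisson point processes on $\mathbb R\times\mathbb R_+$ of intensity $dx\,dt$, independent of the Wiener processes; $(\mathcal F_t)$ is their natural filtration. For each (deterministic) initial state $\rho_0\in\mathcal S(\mathcal H)$, $(\rho(t))$ is the unique $\mathcal S(\mathcal H)$-valued solution (existence and uniqueness are known) of $\rho(t)=\rho_0+\int_0^t\mathcal L(\rho(s-))ds+\sum_{i=0}^p\int_0^t\mathcal G_i(\rho(s-))dW_i(s)+\sum_{i=p+1}^n\int_0^t\int_{\mathbb R}\Big(\frac{\mathcal J_i(\rho(s-))}{\mathrm{tr}[\mathcal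 J_i(\rho(s-))]}-\rho(s-)\Big)\mathbf 1_{0<x<\mathrm{tr}[\mathcal J_i(\rho(s-))]}[N_i(dx,ds)-dx\,ds]$. One has $\frac{d}{dt}\hat\rho(t)=\mathcal L(\hat\rho(t))$. $\mathcal H_S$ is GAS in mean if for all $\rho_0\in\mathcal S(\mathcal H)$, $\lim_{t\to\infty}\|\hat\rho(t)-P_S\hat\rho(t)P_S\|=0$, and GAS almost surely if for all $\rho_0$, $\lim_{t\to\infty}\|\rho(t)-P_S\rho(t)P_S\|=0$ a.s.; the two notions are equivalent, and ''GAS'' refers to either. For a nonnegative process $X(t)$, ''$X(t)=o(f(t))$ in $L^1$-norm'' means $\mathbb E[X(t)]/f(t)\to0$. Convention: $\ln 0=-\infty$. *)

(* Defs.v *)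
From HB Require Import structures.
From mathcomp Require Import all_boot all_order all_algebra.
From mathcomp Require Import complex.
From mathcomp Require Import all_classical all_reals all_analysis.
From mathcomp Require Import measurable_realfun.

Set Implicit Arguments.
Unset Strict Implicit.
Unset Printing Implicit Defensive.
Import Order.TTheory GRing.Theory Num.Theory.
Import numFieldNormedType.Exports.

Local Open Scope classical_set_scope.
Local Open Scope complex_scope.
Local Open Scope sesquilinear_scope.
Local Open Scope ring_scope.

(* The Hilbert space is C^d (column vectors), B(H) is 'M[R[i]]_d, and ^t* is
   the adjoint. *)

Section Operators.
Context {R : realType} {d : nat}.
Local Notation op := 'M[R[i]]_d.

Definition qform (A : op) (v : 'cV[R[i]]_d) : R[i] := (v^t* *m A *m v) 0 0.

(* [0 <= z] in R[i] means that z is real and nonnegative, so this condition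
   forces A to be self-adjoint. *)
Definition psd (A : op) : Prop := forall v, 0 <= qform A v.

Definition density (rho : op) : Prop := psd rho /\ \tr rho = 1.

Definition is_norm (nrm : op -> R) : Prop :=
  [/\ forall A, 0 <= nrm A,
      forall A, nrm A = 0 -> A = 0,
      forall (a : R[i]) A, nrm (a *: A) = Normc.normc a * nrm A &
      forall A B, nrm (A + B) <= nrm A + nrm B].

Definition orth_projector (HS : {vspace 'cV[R[i]]_d}) (P : op) : Prop :=
  [/\ P^t* = P, forall v : 'cV[R[i]]_d, P *m v \in HS &
      forall v : 'cV[R[i]]_d, v \in HS -> P *m v = v].

Definition Vfun (PR rho : op) : R := complex.Re (\tr (PR *m rho)).

Definition lindbladian n (C : 'I_n.+1 -> op) (H rho : op) : op :=
  - ('i *: (H *m rho - rho *m H)) +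
  \sum_i (C i *m rho *m (C i)^t* -
    2^-1 *: ((C i)^t* *m C i *m rho + rho *m (C i)^t* *m C i)).

Definition jumpop (Ci rho : op) : op := Ci *m rho *m Ci^t*.

Definition diffop (Ci rho : op) : op :=
  Ci *m rho + rho *m Ci^t* - \tr ((Ci + Ci^t*) *m rho) *: rho.

(* Condition (SP); the channels 0..p are the diffusive ones. *)
Definition condSP n (p : nat) (C : 'I_n.+1 -> op) (PR : op) : Prop :=
  forall j : 'I_n.+1, (p < j)%N -> forall v : 'cV[R[i]]_d,
    PR *m v = v -> v != 0 ->
    0 < qform (PR *m (C j)^t* *m PR *m C j *m PR) v.

(* Entrywise operations on matrix-valued functions. *)

Definition mxmake (re im : 'I_d -> 'I_d -> R) : op :=
  \matrix_(k, l) (re k l +i* im k l).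

Definition mxcoords (Q : (R[i] -> R) -> 'I_d -> 'I_d -> Prop) : Prop :=
  forall k l, Q (@complex.Re R) k l /\ Q (@complex.Im R) k l.

Definition mxint {dT} {T : measurableType dT} (mu : {measure set T -> \bar R})
    (D : set T) (f : T -> op) : op :=
  mxmake (fun k l => \int[mu]_(x in D) complex.Re (f x k l))
         (fun k l => \int[mu]_(x in D) complex.Im (f x k l)).

Definition mxleft_lim (f : R -> op) (s : R) : op :=
  mxmake (fun k l => lim (complex.Re (f x k l) @[x --> s^'-]))
         (fun k l => lim (complex.Im (f x k l) @[x --> s^'-])).

Definition cadlag (f : R -> R) : Prop :=
  (forall t, 0 <= t -> f x @[x --> t^'+] --> f t) /\
  (forall t, 0 < t -> cvg (f x @[x --> t^'-])).

End Operators.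

Section Noise.
Context {R : realType} {dO : measure_display} {Omega : measurableType dO}.
Variable P : probability Omega R.
Local Notation plane := (measurableTypeR R * measurableTypeR R)%type.

Definition sigma_of {dT} {T : measurableType dT} (X : Omega -> T) :
  set (set Omega) := preimage_set_system setT X measurable.

Definition mutually_independent (I : finType) (G : I -> set (set Omega)) :
    Prop :=
  forall (J : {set I}) (A : I -> set Omega),
    (forall i, i \in J -> G i (A i)) ->
    P (\bigcap_(i in [set` J]) A i) = (\prod_(i in J) P (A i))%E.

Definition wiener (W : R -> Omega -> R) : Prop :=
  [/\ forall t, 0 <= t -> measurable_fun setT (W t),
      {ae P, forall w, W 0 w = 0},
      {ae P, forall w, {within `[0, +oo[, continuous (W ^~ w)}},
      forall s t, 0 <= s -> s < t -> forall A : set R, measurable A ->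
        P ((W t \- W s) @^-1` A) = normal_prob 0 (Num.sqrt (t - s)) A &
      forall k (t : nat -> R), 0 <= t 0%N -> {homo t : i j / (i <= j)%N >-> i <= j} ->
        mutually_independent
          (fun j : 'I_k => sigma_of (W (t j.+1) \- W (t j)))].

Definition dxdt : {measure set plane -> \bar R} :=
  (@lebesgue_measure R \x @lebesgue_measure R)%E.

(* Points of the plane are (x, time).  The second argument of poisson_prob is
   a dummy; poisson_prob 0 is the Dirac mass at 0. *)
Definition poisson_point_process (N : Omega -> {measure set plane -> \bar R}) :
    Prop :=
  [/\ forall w, N w (setT `*` `]-oo, 0[) = 0%E,
      forall w (B : set plane) (m : R), measurable B -> B `<=` `[- m, m] `*` `[0, m] ->
        exists k : nat, N w B = k%:R%:E,
      forall B : set plane, measurable B -> measurable_fun setT (fun w => N w B),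
      forall B : set plane, measurable B -> B `<=` setT `*` `[0, +oo[ ->
        (dxdt B < +oo)%E -> forall k : nat,
        P [set w | N w B = k%:R%:E] = poisson_prob (fine (dxdt B)) 0%N [set k] &
      forall k (B : 'I_k -> set plane),
        (forall j, measurable (B j)) ->
        (forall j, B j `<=` setT `*` `[0, +oo[) ->
        (forall j, (dxdt (B j) < +oo)%E) -> trivIset setT B ->
        mutually_independent (fun j => sigma_of (fun w => N w (B j)))].

Section Driving.
Variables (n p : nat).
(* Channel i is driven by W i when i <= p and by N i when p < i; the other
   components of W and N are never used. *)
Variable W : 'I_n.+1 -> R -> Omega -> R.
Variable N : 'I_n.+1 -> Omega -> {measure set plane -> \bar R}.

Definition noise_upto (i : 'I_n.+1) (t : R) : set (set Omega) :=
  if (i <= p)%N then \bigcup_(s in `[0, t]) sigma_of (W i s)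
  else \bigcup_(B in [set B : set plane | measurable B /\ B `<=` setT `*` `[0, t]])
         sigma_of (fun w => N i w B).

Definition noise_sigma (i : 'I_n.+1) : set (set Omega) :=
  <<s \bigcup_(t in `[0, +oo[) noise_upto i t >>.

Definition driving_noise : Prop :=
  [/\ forall i : 'I_n.+1, (i <= p)%N -> wiener (W i),
      forall i : 'I_n.+1, (p < i)%N -> poisson_point_process (N i) &
      mutually_independent noise_sigma].

(* Usual augmentation (null sets and right limits) of the filtration generated
   by the noise. *)
Definition natural_filtration (t : R) : set (set Omega) :=
  \bigcap_(u in `]t, +oo[)
    <<s (\bigcup_i noise_upto i u) `|` [set A | P.-negligible A] >>.

End Driving.

Section Ito.
Variable F : R -> set (set Omega).

Definition adapted (X : R -> Omega -> R) : Prop :=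
  forall t, 0 <= t -> sigma_of (X t) `<=` F t.

(* The process \sum_(k < sp_size) sp_coef k * 1_(sp_time k, sp_time k.+1]. *)
Record simple_process := SimpleProcess {
  sp_size : nat;
  sp_time : nat -> R;
  sp_coef : nat -> Omega -> R;
  sp_time_ge0 : 0 <= sp_time 0%N;
  sp_time_homo : {homo sp_time : i j / (i <= j)%N >-> i <= j};
  sp_coef_adapted : forall k, sigma_of (sp_coef k) `<=` F (sp_time k);
  sp_coef_bounded : forall k, exists M, forall w, `|sp_coef k w| <= M }.

Definition sp_val (Y : simple_process) (s : R) (w : Omega) : R :=
  \sum_(k < sp_size Y)
    sp_coef Y k w * \1_(`]sp_time Y k, sp_time Y k.+1]) s.

Definition sp_int (W : R -> Omega -> R) (Y : simple_process) (t : R)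
    (w : Omega) : R :=
  \sum_(k < sp_size Y) sp_coef Y k w *
    (W (Num.min (sp_time Y k.+1) t) w - W (Num.min (sp_time Y k) t) w).

(* I is the (continuous version of the) Ito integral of X against W: at each
   time t it is the L^2 limit of integrals of simple processes approximating
   X in L^2(P \x ds). *)
Definition ito_integral (W X I : R -> Omega -> R) : Prop :=
  [/\ adapted I, {ae P, forall w, {within `[0, +oo[, continuous (I ^~ w)}} &
      forall t : R, 0 <= t -> exists Y : nat -> simple_process,
        ((\int[P]_w \int[@lebesgue_measure R]_(s in `[0%R, t])
            ((X s w - sp_val (Y k) s w) ^+ 2)%:E)%E @[k --> \oo] --> 0%E) /\
        ((\int[P]_w ((I t w - sp_int W (Y k) t w) ^+ 2)%:E)%E @[k --> \oo]
           --> 0%E)].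

End Ito.

Section SME.
Context {d n : nat}.
Local Notation op := 'M[R[i]]_d.
Variables (p : nat) (C : 'I_n.+1 -> op) (H : op).
Variable W : 'I_n.+1 -> R -> Omega -> R.
Variable N : 'I_n.+1 -> Omega -> {measure set plane -> \bar R}.
Let F := natural_filtration p W N.

(* Integrand of the i-th jump term at the point z = (x, s); [r] stands for
   rho(s-). *)
Definition jump_integrand (Ci : op) (r : R -> op) (z : plane) : op :=
  let J := jumpop Ci (r z.2) in
  if (0 < z.1) && (z.1 < complex.Re (\tr J))
  then (\tr J)^-1 *: J - r z.2 else 0.

Definition compensated_jump_int (nu : {measure set plane -> \bar R}) (Ci : op)
    (r : R -> op) (t : R) : op :=
  mxint nu (setT `*` `]0, t]) (jump_integrand Ci r) -
  mxint dxdt (setT `*` `]0, t]) (jump_integrand Ci r).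

Record sme_solution (rho0 : op) (rho : R -> Omega -> op) : Prop := {
  sme_state : forall t w, 0 <= t -> density (rho t w);
  sme_adapted :
    mxcoords (fun c k l => adapted F (fun t w => c (rho t w k l)));
  sme_cadlag : {ae P, forall w,
    mxcoords (fun c k l => cadlag (fun t => c (rho t w k l)))};
  sme_equation : exists I : 'I_n.+1 -> R -> Omega -> op,
    (forall i : 'I_n.+1, (i <= p)%N -> mxcoords (fun c k l =>
       ito_integral F (W i)
         (fun s w => c (diffop (C i) (mxleft_lim (rho ^~ w) s) k l))
         (fun t w => c (I i t w k l)))) /\
    {ae P, forall w, forall t, 0 <= t ->
      rho t w = rho0
        + mxint (@lebesgue_measure R) `]0, t]
            (fun s => lindbladian C H (mxleft_lim (rho ^~ w) s))
        + \sum_(i < n.+1 | (i <= p)%N) I i t w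
        + \sum_(i < n.+1 | (p < i)%N)
            compensated_jump_int (N i w) (C i) (mxleft_lim (rho ^~ w)) t} }.

Definition mean_state (rho : R -> Omega -> op) (t : R) : op :=
  mxint P setT (rho t).

End SME.

Section Asymptotics.
Context {d : nat}.
Local Notation op := 'M[R[i]]_d.

(* Below, rho maps an initial state to the solution started there. *)

Definition GAS_mean (nrm : op -> R) (PS : op) (rho : op -> R -> Omega -> op) :
    Prop :=
  forall rho0, density rho0 ->
    nrm (mean_state (rho rho0) t - PS *m mean_state (rho rho0) t *m PS)
      @[t --> +oo] --> 0.

Definition GAS_as (nrm : op -> R) (PS : op) (rho : op -> R -> Omega -> op) :
    Prop :=
  forall rho0, density rho0 -> {ae P, forall w,
    nrm (rho rho0 t w - PS *m rho rho0 t w *m PS) @[t --> +oo] --> 0}.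

(* limsup_(t -> +oo) (1/t) ln (v t), with ln 0 = -oo *)
Definition lyapunov (v : R -> R) : \bar R :=
  limf_esup (fun t : R => (t^-1)%:E * lne (v t)%:E)%E (pinfty_nbhs R).

Definition littleo_as (X : R -> Omega -> R) (f : R -> R) : Prop :=
  {ae P, forall w, X t w / f t @[t --> +oo] --> 0}.

Definition littleo_L1 (X : R -> Omega -> R) (f : R -> R) : Prop :=
  ('E_P[X t] * ((f t)^-1)%:E)%E @[t --> +oo] --> 0%E.

End Asymptotics.
End Noise.

(* Main.v *)
(* Write rho - P_S rho P_S = P_R rho + P_S rho P_R.  Every entry of these two
   blocks is a value of the positive form of rho at a pair of vectors one of
   which lies in the range of P_R, so by Cauchy-Schwarz it is at most
   sqrt (V rho).  Hence ||rho - P_S rho P_S|| <= K sqrt (V rho), and half of the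
   decay rate of V is inherited pathwise; in L^1, E[sqrt V] <= sqrt (E[V]) and
   E[V (rho t)] = V (E[rho t]) reduce the claim to the mean state. *)
Require Import Defs.
From mathcomp Require Import all_boot all_order all_algebra.
From mathcomp Require Import complex.
From mathcomp Require Import all_classical all_reals all_analysis.
From mathcomp Require Import measurable_realfun.
From mathcomp Require Import ring lra.
Import Order.TTheory GRing.Theory Num.Theory.
Import numFieldNormedType.Exports.
Local Open Scope classical_set_scope.
Local Open Scope complex_scope.
Local Open Scope sesquilinear_scope.
Local Open Scope ring_scope.

Set Implicit Arguments.
Unset Strict Implicit.
Unset Printing Implicit Defensive.

(** Conjugates enter as independent data [b], [x], [y], so the expansion is a plain ring
    identity. *)
Lemma bilinear_addZ (F : comNzRingType) d (A : 'M[F]_d) (x y : 'rV[F]_d)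
    (u v : 'cV[F]_d) (b c : F) :
  ((x + b *: y) *m A *m (u + c *: v)) 0 0 =
  (x *m A *m u) 0 0 + (c * (x *m A *m v) 0 0 + b * (y *m A *m u) 0 0)
  + c * b * (y *m A *m v) 0 0.
Proof.
rewrite !mulmxDl !mulmxDr -!scalemxAl -!scalemxAr scalerA !mxE.
ring.
Qed.

(** * Positive operators: Hermitian symmetry, Cauchy-Schwarz, bounds on entries *)

Section PositiveOperators.
Context {R : realType} {d : nat}.
Local Notation op := 'M[R[i]]_d.
Local Notation vec := 'cV[R[i]]_d.
Implicit Types (A B rho P : op) (u v : vec).

(** Conjugate-linear in [u]; its diagonal [sform A u u] is convertible to [qform A u]. *)
Definition sform A u v : R[i] := (u^t* *m A *m v) 0 0.

Lemma adjmx_mul m n p (A : 'M[R[i]]_(m, n)) (B : 'M[R[i]]_(n, p)) :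
  (A *m B)^t* = B^t* *m A^t*.
Proof. by rewrite trmx_mul map_mxM. Qed.

Lemma adjmxE m n (A : 'M[R[i]]_(m, n)) k l : A^t* k l = Num.conj (A l k).
Proof. by rewrite !mxE. Qed.

Lemma qform_addZ A u v (c : R[i]) :
  qform A (u + c *: v) =
  qform A u + (c * sform A u v + Num.conj c * sform A v u)
  + c * Num.conj c * qform A v.
Proof.
rewrite /qform /sform.
have -> : (u + c *: v)^t* = u^t* + Num.conj c *: v^t*.
  by apply/matrixP => i j; rewrite !mxE rmorphD rmorphM.
exact: bilinear_addZ.
Qed.

(** Polarization: [psd] only speaks of the quadratic form, and its reality at the vectors
    [u + c *: v] forces the Hermitian symmetry. *)
Lemma psd_sform_conj A u v :
  psd A -> sform A v u = Num.conj (sform A u v).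
Proof.
move=> Apsd.
have Im0 (z : R[i]) : z \is Num.real -> complex.Im z = 0.
  by move=> /RIm_real [].
(* c = 1 and c = 'i identify the imaginary and the real parts. *)
have real c : complex.Im (c * sform A u v + Num.conj c * sform A v u) = 0.
  have /Im0 := ger0_real (Apsd (u + c *: v)).
  have /Im0 hu := ger0_real (Apsd u).
  have /Im0 hv : c * Num.conj c * qform A v \is Num.real.
    by rewrite realM ?(ger0_real (Apsd v)) // -normCK realX ?normr_real.
  have ImD (x y : R[i]) : complex.Im (x + y) = complex.Im x + complex.Im y.
    by case: x y => ? ? [].
  by rewrite qform_addZ 2!ImD hu hv add0r addr0.
have := real 1; have := real (0 +i* 1).
case: (sform A u v) (sform A v u) => a b [a' b'] /=.
rewrite !(mul0r, mul1r, add0r, mulN1r, oppr0, addr0) => /eqP.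
rewrite subr_eq0 => /eqP <- /eqP; rewrite addr_eq0 => /eqP ->.
by rewrite /Num.conj /= opprK.
Qed.

(* Positivity at u - z^* v, with z = sform A u v, reads
   0 <= qform A u - 2 |z|^2 + |z|^2 qform A v. *)
Lemma psd_sform_le A u v :
  psd A -> qform A v <= 1 -> `|sform A u v| ^+ 2 <= qform A u.
Proof.
move=> Apsd y_le1; set z := sform A u v.
have n_ge0 : 0 <= `|z| ^+ 2 by rewrite exprn_ge0.
have := Apsd (u + (- Num.conj z) *: v).
rewrite qform_addZ (psd_sform_conj u v Apsd) -/z rmorphN /= conjCK.
have -> : qform A u + (- Num.conj z * z + - z * Num.conj z)
    + - Num.conj z * - z * qform A v =
  (qform A u - z * Num.conj z) - z * Num.conj z * (1 - qform A v) by ring.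
rewrite -normCK subr_ge0 => h; rewrite -subr_ge0; apply: le_trans h.
by rewrite mulr_ge0 // subr_ge0.
Qed.

Lemma psd_congruence A (M : op) : psd A -> psd (M^t* *m A *m M).
Proof.
move=> Apsd v; have := Apsd (M *m v).
by rewrite /qform adjmx_mul !mulmxA.
Qed.

Definition ev (k : 'I_d) : vec := delta_mx k 0.

(** The bridge from forms to matrix entries: through it Cauchy-Schwarz bounds every entry of a
    block. *)
Lemma sform_ev A (M M' : op) k l :
  sform A (M *m ev k) (M' *m ev l) = (M^t* *m A *m M') k l.
Proof.
rewrite /sform adjmx_mul !mulmxA.
have -> : (ev k)^t* = delta_mx 0 k.
  by apply/matrixP => i j; rewrite !mxE conjC_nat andbC.
rewrite -!(mulmxA (delta_mx 0 k)) mulmxA -colE.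
by rewrite mxE -rowE mxE.
Qed.

Lemma psd_diag_ge0 A k : psd A -> 0 <= A k k.
Proof.
move=> /(_ (ev k)); rewrite /qform -/(sform A _ _).
by rewrite -[ev k]mul1mx sform_ev trmx1 map_mx1 mul1mx mulmx1.
Qed.

Lemma psd_trace_ge0 A : psd A -> 0 <= \tr A.
Proof. by move=> Apsd; apply: sumr_ge0 => k _; exact: psd_diag_ge0. Qed.

Lemma psd_diag_le_trace A k : psd A -> A k k <= \tr A.
Proof.
move=> Apsd; rewrite /mxtrace (bigD1 k) //= lerDl.
by apply: sumr_ge0 => j _; exact: psd_diag_ge0.
Qed.

(** * Compression by an orthogonal projector and by its complement *)

Section Projector.
Variables (P : op) (P_adj : P^t* = P) (P_idem : P *m P = P).

Lemma trace_compression A : \tr (P *m A *m P) = \tr (P *m A).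
Proof. by rewrite mxtrace_mulC mulmxA P_idem. Qed.

Lemma trace_projector_ge0 A : psd A -> 0 <= \tr (P *m A).
Proof.
move=> /(psd_congruence P); rewrite P_adj => /psd_trace_ge0.
by rewrite trace_compression.
Qed.

(** The left side is a diagonal entry of the positive operator [P *m A *m P], whose trace is the
    right side. *)
Lemma qform_projector_le A k : psd A -> qform A (P *m ev k) <= \tr (P *m A).
Proof.
move=> Apsd; rewrite -trace_compression /qform -/(sform A _ _) sform_ev P_adj.
by apply: psd_diag_le_trace; rewrite -{1}P_adj; apply: psd_congruence.
Qed.

Let Q := 1%:M - P.

Lemma compl_projector_adj : Q^t* = Q.
Proof. by rewrite /Q linearB /= map_mxB trmx1 map_mx1 P_adj. Qed.

Lemma compl_projector_idem : Q *m Q = Q.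
Proof. by rewrite /Q mulmxBl mul1mx mulmxBr mulmx1 P_idem subrr subr0. Qed.

End Projector.

Lemma Vfun_ge0 P rho : P^t* = P -> P *m P = P -> psd rho -> 0 <= Vfun P rho.
Proof.
move=> Padj Pidem /(trace_projector_ge0 Padj Pidem).
by rewrite lecE => /andP[].
Qed.

(** Cauchy-Schwarz with the identity as projector. This uniform bound later makes the entries of the
    random state integrable. *)
Lemma density_normc_le1 rho k l : density rho -> Normc.normc (rho k l) <= 1.
Proof.
move=> [rho_psd rho_tr].
have : `|rho k l| ^+ 2 <= 1.
  have I_adj : (1%:M : op)^t* = 1%:M by rewrite trmx1 map_mx1.
  have I_idem : 1%:M *m 1%:M = 1%:M :> op by rewrite mulmx1.
  have q_le1 j : qform rho (1%:M *m ev j) <= 1.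
    have := qform_projector_le I_adj I_idem j rho_psd.
    by rewrite [1%:M *m rho]mul1mx rho_tr.
  apply: le_trans (q_le1 k).
  rewrite -[rho k l](_ : sform rho (1%:M *m ev k) (1%:M *m ev l) = _).
    exact: psd_sform_le.
  by rewrite sform_ev I_adj mul1mx mulmx1.
by rewrite expr_le1 // -lecR.
Qed.

(** The factor 2 counts the two blocks [Q *m rho] and [P *m rho *m Q], each bounded by the square
    root of [Vfun Q rho]. *)
Lemma density_offdiag_le P rho k l : P^t* = P -> P *m P = P -> density rho ->
  Normc.normc ((rho - P *m rho *m P) k l) <=
  2 * Num.sqrt (Vfun (1%:M - P) rho).
Proof.
move=> Padj Pidem [rho_psd rho_tr]; set Q := 1%:M - P.
have Qadj : Q^t* = Q by apply: compl_projector_adj.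
have Qidem : Q *m Q = Q by apply: compl_projector_idem.
(* The trace is a nonnegative real, so the real part taken in [Vfun] loses nothing. *)
have VE : \tr (Q *m rho) = (Vfun Q rho)%:C.
  apply/eqP; rewrite eq_complex /= eqxx /=.
  by move: (trace_projector_ge0 Qadj Qidem rho_psd); rewrite lecE => /andP[].
(* To be used with [M'] the identity and with [M' = P]; the trace condition supplies the
   normalization that Cauchy-Schwarz asks of the second vector. *)
have bound M' j m : M'^t* = M' -> M' *m M' = M' -> \tr (M' *m rho) <= 1 ->
    Normc.normc ((Q *m rho *m M') j m) <= Num.sqrt (Vfun Q rho).
  move=> M'adj M'idem trM'.
  have : `|(Q *m rho *m M') j m| ^+ 2 <= (Vfun Q rho)%:C.
    rewrite -VE; apply: le_trans (qform_projector_le Qadj Qidem j rho_psd).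
    have -> : (Q *m rho *m M') j m = sform rho (Q *m ev j) (M' *m ev m).
      by rewrite sform_ev Qadj.
    apply: psd_sform_le => //.
    exact: le_trans (qform_projector_le M'adj M'idem m rho_psd) trM'.
  rewrite (_ : `|_| = (Normc.normc ((Q *m rho *m M') j m))%:C) //.
  rewrite -rmorphXn /= lecR => h.
  rewrite -[leLHS]ger0_norm; last first.
    by case: (fun_of_matrix _ j m) => ? ?; exact: sqrtr_ge0.
  by rewrite -sqrtr_sqr ler_wsqrtr.
have -> : rho - P *m rho *m P = Q *m rho *m 1%:M + P *m rho *m Q.
  by rewrite mulmx1 mulmxBr mulmx1 mulmxBl mul1mx addrA subrK.
(* Passing to the adjoint moves [Q] to the left, where [bound] expects it. *)
have -> : (P *m rho *m Q) = (Q *m rho *m P)^t*.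
  apply/matrixP => a b.
  rewrite adjmxE -{1}Padj -{2}Qadj -!sform_ev.
  exact: psd_sform_conj.
rewrite mxE adjmxE [2]mulr2n mulrDl mul1r.
apply: le_trans (le_normcD _ _) _; rewrite lerD //.
- apply: bound; rewrite ?mulmx1 ?mul1mx ?rho_tr //.
  by rewrite trmx1 map_mx1.
- rewrite -[leLHS](_ : Normc.normc ((Q *m rho *m P) l k) = _); last first.
    by case: (fun_of_matrix _ l k) => ? ?; rewrite /Num.conj /= sqrrN.
  apply: bound => //.
  (* The trace of [P *m rho] is at most 1 because the remainder is the trace of [Q *m rho]. *)
  rewrite -rho_tr -subr_ge0 -linearB /= -{1}[rho]mul1mx -mulmxBl.
  exact: trace_projector_ge0.
Qed.

(** Expansion in matrix units, so that an arbitrary norm enters only through finitely many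
    constants. *)
Lemma norm_le_entries (nrm : op -> R) A : is_norm nrm ->
  nrm A <= \sum_k \sum_l Normc.normc (A k l) * nrm (delta_mx k l).
Proof.
move=> [nrm_ge0 nrm_eq0 nrmZ nrmD].
have nrm0 : nrm 0 = 0 by rewrite -(scale0r 0) nrmZ Normc.normc0 mul0r.
have nrm_sum (I : finType) (F : I -> op) : nrm (\sum_i F i) <= \sum_i nrm (F i).
  elim/big_ind2 : _ => [|a b c e ab ce|//]; first by rewrite nrm0.
  by apply: le_trans (nrmD _ _) _; rewrite lerD.
rewrite {1}[A]matrix_sum_delta; apply: le_trans (nrm_sum _ _) _.
apply: ler_sum => k _; apply: le_trans (nrm_sum _ _) _.
by apply: ler_sum => l _; rewrite nrmZ.
Qed.

(** [K] is chosen before [P] and [rho]: one constant serves all times, outcomes and initial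
    states. *)
Lemma density_norm_offdiag_le (nrm : op -> R) : is_norm nrm ->
  exists2 K : R, 0 <= K & forall P rho, P^t* = P -> P *m P = P -> density rho ->
    nrm (rho - P *m rho *m P) <= K * Num.sqrt (Vfun (1%:M - P) rho).
Proof.
move=> nrm_norm; have [nrm_ge0 _ _ _] := nrm_norm.
exists (2 * \sum_k \sum_l nrm (delta_mx k l)).
  by rewrite mulr_ge0 // sumr_ge0 // => k _; rewrite sumr_ge0.
move=> P rho Padj Pidem drho; apply: le_trans (norm_le_entries _ nrm_norm) _.
rewrite mulrAC mulr_sumr ler_sum // => k _; rewrite mulr_sumr ler_sum // => l _.
by rewrite ler_wpM2r // density_offdiag_le.
Qed.

End PositiveOperators.

(** Every column of [PS] lies in [HS], which [PS] fixes pointwise. *)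
Lemma orth_projector_idem (R : realType) d (HS : {vspace 'cV[R[i]]_d}) PS :
  orth_projector HS PS -> PS *m PS = PS.
Proof.
move=> [_ PS_in PS_id]; apply/matrixP => k j.
have := PS_id _ (PS_in (delta_mx j 0)).
by rewrite mulmxA -!colE => /colP/(_ k); rewrite !mxE.
Qed.

(** * From Lyapunov exponents to exponential decay, for deterministic functions of time *)

Section ExponentialDecay.
Context {R : realType}.
Implicit Types (v : R -> R) (a b c K : R).

(** The gap [b < a] makes the bound strict, so the supremum over some neighbourhood of [+oo] is
    already below [- b]. *)
Lemma lyapunov_lt_expR v a b : (lyapunov v <= (- a)%:E)%E -> b < a ->
  \forall t \near +oo, v t <= expR (- (b * t)).
Proof.
move=> lyap_le ba; have : (lyapunov v < (- b)%:E)%E.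
  by apply: le_lt_trans lyap_le _; rewrite lte_fin ltrN2.
move=> /ereal_inf_lt[_ [S S_nbhs <-]] sup_lt.
near=> t; have t_gt0 : 0 < t by near: t; exact: nbhs_pinfty_gt.
have St : S t by near: t.
have : ((t^-1)%:E * lne (v t)%:E < (- b)%:E)%E.
  by apply: le_lt_trans sup_lt; apply: ereal_sup_ubound; exists t => //; near: t.
(* If [v t <= 0], which includes the case of logarithm [-oo], positivity of the exponential
   suffices. *)
have [v_le0 _|v_gt0] := leP (v t) 0; first exact: le_trans (expR_ge0 _).
rewrite lne_EFin // -EFinM lte_fin => h.
rewrite -(lnK (x := v t)) ?posrE // ler_expR ltW //.
by move: h; rewrite mulrC ltr_pdivrMr // mulNr.
Unshelve. all: by end_near. Qed.

Lemma cvg_expR_decay K c : 0 < c -> K * expR (- (c * t)) @[t --> +oo] --> 0.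
Proof.
move=> c_gt0; rewrite -(mulr0 K); apply: cvgMl_tmp.
have c_oo : c * t @[t --> +oo] --> +oo.
  exact: gt0_cvgMry.
exact: (cvg_comp _ _ c_oo (@cvgr_expR R)).
Qed.

Lemma sqrt_le_expR (x b t : R) :
  x <= expR (- (b * t)) -> Num.sqrt x <= expR (- (2^-1 * b * t)).
Proof.
move=> /ler_wsqrtr/le_trans; apply.
rewrite -[leRHS]ger0_norm ?expR_ge0 // -sqrtr_sqr -expRM_natl.
by apply/ler_wsqrtr; rewrite ler_expR; lra.
Qed.

(** Half of [eps] is spent on passing from the limsup to an eventual bound; the other half, halved
    again by the square root, leaves the decay rate [eps / 4]. *)
Lemma expR_ratio (a eps t : R) :
  expR (- (2^-1 * (a - 2^-1 * eps) * t)) / expR (- (2^-1 * (a - eps) * t)) =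
  expR (- (4^-1 * eps * t)).
Proof. by rewrite -expRN -expRD; congr expR; lra. Qed.

Lemma sqrt_littleo (X v : R -> R) a eps K : 0 <= K -> 0 < eps ->
  (lyapunov v <= (- a)%:E)%E ->
  (forall t, 0 <= t -> 0 <= X t <= K * Num.sqrt (v t)) ->
  X t / expR (- (2^-1 * (a - eps) * t)) @[t --> +oo] --> 0.
Proof.
move=> K_ge0 eps_gt0 lyap_le X_bd.
have b_lt : a - 2^-1 * eps < a by lra.
have c_gt0 : 0 < 4^-1 * eps by lra.
apply: (@squeeze_cvgr _ _ _ _ (cst 0) (fun t => K * expR (- (4^-1 * eps * t)))).
- near=> t; have t_ge0 : 0 <= t by near: t; exact: nbhs_pinfty_ge.
  have v_le : v t <= expR (- ((a - 2^-1 * eps) * t)).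
    by near: t; exact: lyapunov_lt_expR lyap_le b_lt.
  have /andP[X_ge0 X_le] := X_bd t t_ge0.
  rewrite divr_ge0 ?expR_ge0 //= -(expR_ratio a) [leRHS]mulrA.
  rewrite ler_wpM2r ?invr_ge0 ?expR_ge0 //; apply: le_trans X_le _.
  by rewrite ler_wpM2l // sqrt_le_expR.
- exact: cvg_cst.
- exact: cvg_expR_decay.
Unshelve. all: by end_near. Qed.

End ExponentialDecay.

(** * Expectations of linear functionals and of square roots, and decay in L^1 *)

Section Expectation.
Context {R : realType} {dO : measure_display} {Omega : measurableType dO}.
Variable P : probability Omega R.

(* No measurability of f is needed: the integral of a nonnegative function is a
   supremum over the simple functions below it. *)
Lemma ge0_le_integral_nonmeas (f g : Omega -> \bar R) :
  (forall w, 0 <= f w)%E -> (forall w, f w <= g w)%E ->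
  (\int[P]_w f w <= \int[P]_w g w)%E.
Proof.
move=> f_ge0 fg; rewrite !ge0_integralTE //; last first.
  by move=> w; apply: le_trans (fg w).
apply: le_ereal_sup => _ [h h_le <-]; exists h => // w.
exact: le_trans (h_le w) (fg w).
Qed.

(** Both claims go through one induction, since additivity at each step needs the tail to be
    integrable. *)
Lemma Rintegral_sum (I : Type) (s : seq I) (F : I -> Omega -> R) :
  (forall i, P.-integrable setT (EFin \o F i)) ->
  P.-integrable setT (EFin \o (fun w => \sum_(i <- s) F i w)) /\
  \int[P]_w (\sum_(i <- s) F i w) = \sum_(i <- s) \int[P]_w F i w.
Proof.
move=> F_int; elim: s => [|i s [IHint IH]].
  split; last first.
    rewrite big_nil -[RHS](mul0r (fine (P setT))) -Rintegral_cst //.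
    by apply: eq_Rintegral => w _; rewrite big_nil.
  by apply: eq_integrable (integrable0 _ _) => // w _ /=; rewrite big_nil.
rewrite big_cons -IH -RintegralD //; split; last first.
  by apply: eq_Rintegral => w _; rewrite big_cons.
apply: eq_integrable (integrableD _ (F_int i) IHint) => //.
by move=> w _ /=; rewrite big_cons.
Qed.

(** [Vfun A] is a real linear combination of the real and imaginary parts of the entries, which are
    what [mxint] integrates. *)
Lemma Rintegral_Vfun d (A : 'M[R[i]]_d) (X : Omega -> 'M[R[i]]_d) :
  mxcoords (fun c k l => P.-integrable setT (EFin \o (fun w => c (X w k l)))) ->
  P.-integrable setT (EFin \o (fun w => Vfun A (X w))) /\
  Vfun A (mxint P setT X) = \int[P]_w Vfun A (X w).
Proof.
move=> X_int.
pose T (k l : 'I_d) (Y : 'M[R[i]]_d) :=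
  complex.Re (A k l) * complex.Re (Y l k) - complex.Im (A k l) * complex.Im (Y l k).
have VE Y : Vfun A Y = \sum_k \sum_l T k l Y.
  rewrite /Vfun /mxtrace raddf_sum; apply: eq_bigr => k _.
  rewrite mxE raddf_sum; apply: eq_bigr => l _.
  by rewrite /T; case: (A k l) (Y l k) => ? ? [].
have T_int k l : P.-integrable setT (EFin \o (fun w => T k l (X w))) /\
    T k l (mxint P setT X) = \int[P]_w T k l (X w).
  have [re_int im_int] := X_int l k.
  have re_int' : P.-integrable setT
      (EFin \o (fun w => complex.Re (A k l) * complex.Re (X w l k))).
    exact: integrableZl measurableT _ _ re_int.
  have im_int' : P.-integrable setT
      (EFin \o (fun w => complex.Im (A k l) * complex.Im (X w l k))).
    exact: integrableZl measurableT _ _ im_int.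
  split; first by apply: eq_integrable (integrableB _ re_int' im_int').
  by rewrite /T RintegralB // !RintegralZl // /mxint /mxmake !mxE.
have sum_int k := Rintegral_sum (index_enum 'I_d) (fun l => (T_int k l).1).
have [int2 eq2] := Rintegral_sum (index_enum 'I_d) (fun k => (sum_int k).1).
split.
  by apply: eq_integrable int2 => // w _ /=; rewrite VE.
transitivity (\int[P]_w \sum_k \sum_l T k l (X w)); last first.
  by apply: eq_Rintegral => w _; rewrite VE.
rewrite VE eq2; apply: eq_bigr => k _; rewrite (sum_int k).2.
by apply: eq_bigr => l _; rewrite (T_int k l).2.
Qed.

(* sqrt v <= (v / c + c) / 2 for c > 0, which with c ^+ 2 >= E[v] gives
   E[sqrt v] <= c, whether or not E[v] vanishes. *)
Lemma expectation_sqrt_le (X v : Omega -> R) (K c : R) :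
  0 <= K -> 0 < c -> P.-integrable setT (EFin \o v) ->
  (forall w, 0 <= v w) -> (forall w, 0 <= X w <= K * Num.sqrt (v w)) ->
  \int[P]_w v w <= c ^+ 2 -> ('E_P[X] <= (K * c)%:E)%E.
Proof.
move=> K_ge0 c_gt0 v_int v_ge0 X_bd v_le.
pose g w := K * 2^-1 * c^-1 * v w + K * 2^-1 * c.
have int1 := integrableZl measurableT (K * 2^-1 * c^-1) v_int.
have int2 : P.-integrable setT (EFin \o cst (K * 2^-1 * c)).
  exact: finite_measure_integrable_cst.
have g_int : P.-integrable setT (EFin \o g) by exact: (integrableD _ int1 int2).
have Xg w : X w <= g w.
  have /andP[_ /le_trans] := X_bd w; apply.
  have -> : g w = K * (2^-1 * (c^-1 * Num.sqrt (v w) ^+ 2 + c)).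
    by rewrite /g sqr_sqrtr //; ring.
  rewrite ler_wpM2l //; set s := Num.sqrt (v w).
  have : 0 <= c^-1 * (s - c) ^+ 2 by rewrite mulr_ge0 ?sqr_ge0 ?invr_ge0 ?ltW.
  have -> : c^-1 * (s - c) ^+ 2 = c^-1 * s ^+ 2 - 2 * s + c.
    by field; rewrite gt_eqF.
  lra.
rewrite unlock; apply: le_trans (_ : (\int[P]_w (g w)%:E <= _)%E).
  apply: ge0_le_integral_nonmeas => w; rewrite lee_fin //.
  by have /andP[] := X_bd w.
rewrite -[leLHS]fineK; last exact: integrable_fin_num.
rewrite lee_fin -[leLHS]/(Rintegral P setT g) RintegralD // RintegralZl //.
rewrite Rintegral_cst // (_ : fine _ = 1) ?mulr1; last first.
  by rewrite [X in fine X]probability_setT.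
have : c^-1 * \int[P]_w v w <= c by rewrite ler_pdivrMl // -expr2.
move=> /(ler_wpM2l K_ge0); lra.
Qed.

Lemma sqrt_littleo_L1 (X v : R -> Omega -> R) (V : R -> R) K a eps :
  0 <= K -> 0 < eps -> (lyapunov V <= (- a)%:E)%E ->
  (forall t, 0 <= t -> P.-integrable setT (EFin \o v t)) ->
  (forall t, 0 <= t -> \int[P]_w v t w = V t) ->
  (forall t w, 0 <= t -> 0 <= v t w) ->
  (forall t w, 0 <= t -> 0 <= X t w <= K * Num.sqrt (v t w)) ->
  littleo_L1 P X (fun t => expR (- (2^-1 * (a - eps) * t))).
Proof.
move=> K_ge0 eps_gt0 lyap_le v_int vE v_ge0 X_bd.
have b_lt : a - 2^-1 * eps < a by lra.
have c_gt0 : 0 < 4^-1 * eps by lra.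
apply: (@squeeze_cvge _ _ _ _ (cst 0%E) _
  (EFin \o (fun t => K * expR (- (4^-1 * eps * t))))).
- near=> t; have t_ge0 : 0 <= t by near: t; exact: nbhs_pinfty_ge.
  have V_le : V t <= expR (- ((a - 2^-1 * eps) * t)).
    by near: t; exact: lyapunov_lt_expR lyap_le b_lt.
  have inv_ge0 : (0 <= ((expR (- (2^-1 * (a - eps) * t)))^-1)%:E)%E.
    by rewrite lee_fin invr_ge0 expR_ge0.
  apply/andP; split.
    rewrite mule_ge0 // expectation_ge0 // => w.
    by have /andP[] := X_bd t w t_ge0.
  rewrite /= -(expR_ratio a) mulrA EFinM; apply: lee_wpmul2r => //.
  (* Here [c] is the square root of the exponential bound on [V t], hence positive even if [V t]
     vanishes. *)
  apply: (@expectation_sqrt_le _ (v t)) => //.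
  - exact: expR_gt0.
  - exact: v_int.
  - by move=> w; exact: v_ge0.
  - by move=> w; exact: X_bd.
  - rewrite vE // -expRM_natl; apply: le_trans V_le _.
    by rewrite ler_expR; lra.
- exact: cvg_cst.
- by apply: cvg_EFin; [exact: nearW | exact: cvg_expR_decay].
Unshelve. all: by end_near. Qed.

(** * Measurability and integrability of the random state *)

Lemma natural_filtration_measurable n p (W : 'I_n.+1 -> R -> Omega -> R)
    (N : 'I_n.+1 -> Omega ->
      {measure set (measurableTypeR R * measurableTypeR R) -> \bar R}) t :
  measure_is_complete P -> driving_noise P p W N ->
  natural_filtration P p W N t `<=` measurable.
Proof.
(* The right limit is an intersection over all [u > t]; any one member will do, here [u = t + 1]. *)
move=> P_complete [W_wiener N_poisson _] A /(_ (t + 1)).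
have : (t + 1 \in `]t, +oo[)%R by rewrite in_itv /= andbT ltrDl.
move=> /[swap] /[apply]; apply: smallest_sub.
  exact: sigma_algebra_measurable.
(* A generator is a noise event or a negligible set; completeness makes the latter measurable. *)
move=> B [[i _]|]; last exact: P_complete.
rewrite /noise_upto; case: leqP => [ip|pi] [].
  move=> s /= s_itv [S S_meas <-].
  have [W_meas _ _ _ _] := W_wiener i ip.
  apply: W_meas => //; move: s_itv; rewrite in_itv /=; by case/andP.
move=> D [D_meas _] [S S_meas <-].
have [_ _ N_meas _ _] := N_poisson i pi.
exact: N_meas.
Qed.

Lemma adapted_measurable (F : R -> set (set Omega)) (X : R -> Omega -> R) t :
  F t `<=` measurable -> adapted F X -> 0 <= t -> measurable_fun setT (X t).
Proof. by move=> FM /(_ t) X_ad t_ge0 _ S S_meas; apply/FM/X_ad => //; exists S. Qed.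

End Expectation.
Lemma normr_coord_le (R : realType) (z : R[i]) :
  `|complex.Re z| <= Normc.normc z /\ `|complex.Im z| <= Normc.normc z.
Proof.
case: z => x y /=; rewrite -!sqrtr_sqr.
by split; apply: ler_wsqrtr; rewrite ?lerDl ?lerDr sqr_ge0.
Qed.

(** Adaptedness gives measurability and the density property gives a bound by 1, which is enough on
    a probability space. *)
Lemma sme_coord_integrable (R : realType) (dO : measure_display)
    (Omega : measurableType dO) (P : probability Omega R) d n p
    (C : 'I_n.+1 -> 'M[R[i]]_d) H (W : 'I_n.+1 -> R -> Omega -> R)
    (N : 'I_n.+1 -> Omega ->
      {measure set (measurableTypeR R * measurableTypeR R) -> \bar R})
    rho0 (rho : R -> Omega -> 'M[R[i]]_d) t :
  measure_is_complete P -> driving_noise P p W N ->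
  sme_solution P p C H W N rho0 rho -> 0 <= t ->
  mxcoords (fun c k l => P.-integrable setT (EFin \o (fun w => c (rho t w k l)))).
Proof.
move=> P_complete noise sol t_ge0 k l.
have F_meas := natural_filtration_measurable (t := t) P_complete noise.
have [re_ad im_ad] := sme_adapted sol k l.
have bd w : Normc.normc (rho t w k l) <= 1.
  exact: density_normc_le1 (sme_state sol w t_ge0).
have fin : (P setT < +oo)%E by rewrite probability_setT ltry.
have bounded_int (c : R[i] -> R) : (forall z, `|c z| <= Normc.normc z) ->
    measurable_fun setT (fun w => c (rho t w k l)) ->
    P.-integrable setT (EFin \o (fun w => c (rho t w k l))).
  move=> c_le c_meas; apply: measurable_bounded_integrable => //.
  exists 1; split=> // M M_gt1 w _ /=.
  by apply: le_trans (c_le _) _; apply: le_trans (bd w) _; exact: ltW.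
split; apply: bounded_int.
- by move=> z; have [] := normr_coord_le z.
- exact: adapted_measurable F_meas re_ad t_ge0.
- by move=> z; have [] := normr_coord_le z.
- exact: adapted_measurable F_meas im_ad t_ge0.
Qed.

Theorem corollary1p4 (R : realType) (dO : measure_display)
    (Omega : measurableType dO) (P : probability Omega R)
    (P_complete : measure_is_complete P)
    (d n p : nat) (le_pn : (p <= n)%N)
    (nrm : 'M[R[i]]_d -> R) (nrm_norm : is_norm nrm)
    (C : 'I_n.+1 -> 'M[R[i]]_d) (H : 'M[R[i]]_d) (H_selfadjoint : H^t* = H)
    (W : 'I_n.+1 -> R -> Omega -> R)
    (N : 'I_n.+1 -> Omega ->
           {measure set (measurableTypeR R * measurableTypeR R) -> \bar R})
    (noise : driving_noise P p W N)
    (rho : 'M[R[i]]_d -> R -> Omega -> 'M[R[i]]_d)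
    (rho_solution : forall rho0, density rho0 ->
       sme_solution P p C H W N rho0 (rho rho0))
    (HS : {vspace 'cV[R[i]]_d}) (PS PR : 'M[R[i]]_d)
    (PS_proj : orth_projector HS PS) (PR_def : PR = 1%:M - PS)
    (HS_GAS : GAS_mean P nrm PS rho \/ GAS_as P nrm PS rho)
    (alpha0 : R) (alpha0_gt0 : 0 < alpha0)
    (alpha0_mean : forall rho0, density rho0 ->
       (lyapunov (fun t => Vfun PR (mean_state P (rho rho0) t))
          <= (- alpha0)%:E)%E)
    (alpha0_as : forall rho0, density rho0 -> {ae P, forall w,
       (lyapunov (fun t => Vfun PR (rho rho0 t w)) <= (- alpha0)%:E)%E}) :
  (forall rho0, density rho0 -> forall eps : R, 0 < eps ->
     littleo_as P (fun t w => nrm (rho rho0 t w - PS *m rho rho0 t w *m PS))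
       (fun t => expR (- (2^-1 * (alpha0 - eps) * t))) /\
     littleo_L1 P (fun t w => nrm (rho rho0 t w - PS *m rho rho0 t w *m PS))
       (fun t => expR (- (2^-1 * (alpha0 - eps) * t)))) /\
  (condSP p C PR -> forall beta0 : R, alpha0 <= beta0 ->
     (forall rho0, density rho0 -> {ae P, forall w,
        (lyapunov (fun t => Vfun PR (rho rho0 t w)) <= (- beta0)%:E)%E}) ->
     forall rho0, density rho0 -> forall eps : R, 0 < eps ->
       littleo_as P (fun t w => nrm (rho rho0 t w - PS *m rho rho0 t w *m PS))
         (fun t => expR (- (2^-1 * (beta0 - eps) * t)))).
Proof.
have [PS_adj _ _] := PS_proj; have PS_idem := orth_projector_idem PS_proj.
have [K K_ge0 K_bd] := density_norm_offdiag_le nrm_norm.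
have [nrm_ge0 _ _ _] := nrm_norm.
have bound rho0 t w : density rho0 -> 0 <= t ->
    0 <= nrm (rho rho0 t w - PS *m rho rho0 t w *m PS)
      <= K * Num.sqrt (Vfun PR (rho rho0 t w)).
  move=> drho0 t_ge0; rewrite nrm_ge0 /= PR_def.
  by apply: K_bd => //; exact: sme_state (rho_solution _ drho0) _ _ t_ge0.
(* The rate [a] is left free to cover both [alpha0] and [beta0]. The norm bound holds for every [w],
   so the only exceptional null set is that of the Lyapunov hypothesis. *)
have almost_surely a rho0 eps : density rho0 -> 0 < eps ->
    {ae P, forall w,
      (lyapunov (fun t => Vfun PR (rho rho0 t w)) <= (- a)%:E)%E} ->
    littleo_as P (fun t w => nrm (rho rho0 t w - PS *m rho rho0 t w *m PS))
      (fun t => expR (- (2^-1 * (a - eps) * t))).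
  move=> drho0 eps_gt0; apply: filterS => w lyap_le.
  by apply: sqrt_littleo K_ge0 eps_gt0 lyap_le _ => t t_ge0; exact: bound.
split; last first.
  move=> _ beta0 _ beta0_as rho0 drho0 eps eps_gt0.
  exact: almost_surely drho0 eps_gt0 (beta0_as _ drho0).
move=> rho0 drho0 eps eps_gt0; split.
  exact: almost_surely drho0 eps_gt0 (alpha0_as _ drho0).
have coord_int t := sme_coord_integrable P_complete noise (rho_solution _ drho0) (t := t).
(* The mean of this process is [Vfun PR] of the mean state, whose exponent [alpha0_mean]
   controls. *)
apply: (@sqrt_littleo_L1 _ _ _ _ _ (fun t w => Vfun PR (rho rho0 t w))
  _ K _ _ K_ge0 eps_gt0 (alpha0_mean _ drho0)).
- by move=> t t_ge0; have [] := Rintegral_Vfun PR (coord_int t t_ge0).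
- by move=> t t_ge0; have [_ <-] := Rintegral_Vfun PR (coord_int t t_ge0).
- move=> t w t_ge0; have [rho_psd _] := sme_state (rho_solution _ drho0) w t_ge0.
  rewrite PR_def; apply: Vfun_ge0 => //.
    exact: compl_projector_adj.
  exact: compl_projector_idem.
- by move=> t w t_ge0; exact: bound.
Qed.
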